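(* Let $\iota\in I(n)$, let $\pi\in IP(n)$ be the corresponding idempotent permutation, and let $\gamma$ be the sequence obtained by associatively permuting $\pi$ (characteristic function defined implicitly). There is an $\mathcal{O}(n)$ time algorithm that generates the linearly ordered arrangement of $\iota$ in-place of $\gamma$ using $\log n$ bits.
   Context: $[n]=\{1,\ldots,n\}$. $I(n)$ is the set of idempotent maps $\iota:[n]\to[n]$ ($\iota(\iota(x))=\iota(x)$ for all $x$). For $\iota\in I(n)$ with fixed points $a_1<\cdots<a_k$, put $[a_i]_\iota=\{x\in[n]:\iota(x)=a_i\}$. An idempotent permutation of degree $k$ ($1\le k\le n$) is a permutation $\pi$ of $[n]$ together with a distinguished set of indices $A=\{a_1<\cdots<a_k\}\subseteq[n]$ such that the values $c_i=\pi(a_i)$ satisfy $1=c_1<c_2<\cdots<c_k$; put $c_{k+1}=n+1$ and $[a_i]_\pi=\{x\in[n]:c_i\le\pi(x)<c_{i+1}\}$. $IP(n)$ is the set of idempotent permutations of all degrees. $\pi$ corresponds to $\iota$ if $A$ is the set of fixed points of $\iota$ and $[a_i]_\pi=[a_i]_\iota$ for all $i$. Associatively permuting $\pi$, stored with the entries at indices in $A$ negated (characteristic function defined implicitly), yields the sequence $\gamma$ with $\gamma(c_i)=-a_i$ for $i=1,\ldots,k$ and $\gamma(x)=x$ for $x\in[n]\setminus\{c_1,\ldots,c_k\}$. The linearly ordered arrangement of $\iota$ is the sequence of values $\iota(1),\ldots,\iota(n)$ sorted in nondecreasing order. ''In-place of $\gamma$'' means that an array initially holding $\gamma$ finally holds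 the result. Computation is on a unit-cost random access machine; ''$\log n$ bits'' means that besides the array one auxiliary variable of $\log n$ bits (an index or value of magnitude $O(n)$) is used. *)

(* Defs.v *)
From mathcomp Require Import all_boot all_order all_algebra all_fingroup.

Set Implicit Arguments.
Unset Strict Implicit.
Unset Printing Implicit Defensive.

(* The element x of [n] = {1, ..., n} is represented by the ordinal of value
   x - 1; whenever it is used as a number (array index, stored entry) it is
   written x.+1, so that the sign of a stored entry is meaningful. *)

(* [enum A] is increasing, so these are a_1 < ... < a_k and c_1, ..., c_k. *)
Definition a_seq n (A : {set 'I_n}) : seq nat := [seq (a : 'I_n).+1 | a <- enum A].
Definition c_seq n (pi : {perm 'I_n}) (A : {set 'I_n}) : seq nat := [seq (pi a).+1 | a <- enum A].

(* c_at i is c_(i+1) for i < k, and c_at k is c_(k+1) = n + 1. *)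
Definition c_at n (pi : {perm 'I_n}) (A : {set 'I_n}) (i : nat) : nat :=
  nth n.+1 (c_seq pi A) i.

Definition idempotent_perm n (pi : {perm 'I_n}) (A : {set 'I_n}) : bool :=
  [&& A != set0, c_at pi A 0 == 1 & sorted ltn (c_seq pi A)].

Definition perm_class n (pi : {perm 'I_n}) (A : {set 'I_n}) (i : nat) : {set 'I_n} :=
  [set x : 'I_n | c_at pi A i <= (pi x).+1 < c_at pi A i.+1].

(* gamma (c_i) = - a_i, and gamma (x) = x for x outside {c_1, ..., c_k};
   the entry gamma (x) is at position x - 1 of the sequence. *)
Definition gamma n (pi : {perm 'I_n}) (A : {set 'I_n}) : seq int :=
  [seq if x \in c_seq pi A
       then (- Posz (nth 0%N (a_seq A) (index x (c_seq pi A))))%R else Posz x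
  | x <- iota 1 n].

Definition corresponds n (pi : {perm 'I_n}) (A : {set 'I_n})
    (f : 'I_n -> 'I_n) : Prop :=
  A = [set x | f x == x] /\
  forall i : 'I_#|A|, perm_class pi A i = [set x | f x == enum_val i].

Definition linear_arrangement n (f : 'I_n -> 'I_n) : seq int :=
  [seq Posz v | v <- sort leq [seq (f x).+1 | x <- enum 'I_n]].

(* A random access machine with addition and subtraction whose only data
   memory is an array with cells 1, ..., n and a single auxiliary word.
   [Len] is the (read-only) input size n.  Each instruction performs one
   operation and costs one unit of time. *)

Inductive address :=
  | Direct of int
  | Indexed of int.

Inductive operand := Const of int | Len | Aux | Cell of address.

Inductive destination := ToAux | ToCell of address.

Inductive instruction :=
  | IAdd of destination & operand & operand
  | ISub of destination & operand & operand
  | IJumpLe of operand & operand & nat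
  | IHalt.

Definition program := seq instruction.

Record config := Config { pc : nat; aux : int; arr : seq int }.

Definition resolve (s : config) (d : address) : int :=
  match d with Direct z => z | Indexed z => (aux s + z)%R end.

Definition read_cell (s : config) (z : int) : option int :=
  if z is Posz k.+1 then onth (arr s) k else None.

Definition write_cell (s : config) (z w : int) : option config :=
  if z is Posz k.+1 then
    if k < size (arr s)
    then Some (Config (pc s) (aux s) (set_nth 0%R (arr s) k w))
    else None
  else None.

Definition eval (s : config) (o : operand) : option int :=
  match o with
  | Const z => Some z
  | Len => Some (Posz (size (arr s)))
  | Aux => Some (aux s)
  | Cell d => read_cell s (resolve s d)
  end.

Definition store (s : config) (d : destination) (w : int) : option config :=
  match d with
  | ToAux => Some (Config (pc s) w (arr s))
  | ToCell e => write_cell s (resolve s e) w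
  end.

Definition goto (l : nat) (s : config) : config := Config l (aux s) (arr s).

Definition assign (s : config) (op : int -> int -> int) (d : destination)
    (o1 o2 : operand) : option config :=
  match eval s o1, eval s o2 with
  | Some u, Some v => omap (goto (pc s).+1) (store s d (op u v))
  | _, _ => None
  end.

(* [None] when the machine has halted or faults: an access outside the array,
   or a program counter outside the program. *)
Definition step (P : program) (s : config) : option config :=
  match onth P (pc s) with
  | Some (IAdd d o1 o2) => assign s +%R d o1 o2
  | Some (ISub d o1 o2) => assign s (fun u v => u - v)%R d o1 o2
  | Some (IJumpLe o1 o2 l) =>
      match eval s o1, eval s o2 with
      | Some u, Some v => Some (goto (if (u <= v)%R then l else (pc s).+1) s)
      | _, _ => None
      end
  | Some IHalt | None => None
  end.

Definition halted (P : program) (s : config) : Prop :=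
  onth P (pc s) = Some IHalt.

Definition run (P : program) (g : seq int) (t : nat) : option config :=
  iter t (obind (step P)) (Some (Config 0 0%R g)).

(* The cells may only hold values of the range {-n, ..., n} of signed indices,
   so that no extra information can be packed in the array. *)
Definition fits (c n : nat) (s : config) : Prop :=
  `|aux s|%N <= c * n /\ all (fun z : int => `|z|%N <= n) (arr s).

(* Started on the array g, P halts within T steps with the array holding r,
   all configurations on the way satisfying [fits c (size g)]. *)
Definition computes_in_place (P : program) (T c : nat) (g r : seq int) : Prop :=
  exists (t : nat) (s : config),
    [/\ t <= T, run P g t = Some s, halted P s, arr s = r &
        forall t' s', t' <= t -> run P g t' = Some s' -> fits c (size g) s'].

(* Main.v *)
Require Import Defs.
From mathcomp Require Import all_boot all_order all_algebra all_fingroup.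
From mathcomp Require Import zify.

Set Implicit Arguments.
Unset Strict Implicit.

(** The class of [a_i] has [c_(i+1) - c_i] elements, so in the sorted
    arrangement the value [a_i] occupies exactly the positions
    [c_i, ..., c_(i+1) - 1].  The sign of [gamma] marks the positions [c_i], and
    there the entry is [- a_i].  One pass from left to right therefore
    suffices: negate a negative entry, and overwrite a positive one by its
    (already final) left neighbour. *)

(** * Machine traces along which an invariant holds *)

Inductive execution (P : program) (Q : config -> Prop) :
    nat -> config -> config -> Prop :=
  | ExecutionNil s : Q s -> execution P Q 0 s s
  | ExecutionCons t s s' s'' : Q s -> step P s = Some s' ->
      execution P Q t s' s'' -> execution P Q t.+1 s s''.

Lemma execution_trans P Q t t' s s' s'' :
  execution P Q t s s' -> execution P Q t' s' s'' ->
  execution P Q (t + t') s s''.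
Proof.
elim=> [//|{}t {}s s1 {}s' Qs Hstep _ IH] H.
by apply: ExecutionCons Qs Hstep (IH H).
Qed.

(** The machine is deterministic, so whatever it reaches at an intermediate time lies on the trace,
    where [Q] holds. This turns traces, which concatenate easily, into the form asked for by
    [computes_in_place]. *)
Lemma execution_iter P Q t s s' : execution P Q t s s' ->
  iter t (obind (step P)) (Some s) = Some s' /\
  forall t' s'', t' <= t -> iter t' (obind (step P)) (Some s) = Some s'' ->
    Q s''.
Proof.
elim=> [{}s Qs|{}t {}s s1 {}s' Qs Hstep _ [Hrun HQ]].
  by split=> // -[|//] s'' _ [<-].
split=> [|[|t'] s'' Ht]; first by rewrite iterSr /= Hstep.
  by case=> <-.
by rewrite iterSr /= Hstep; apply: HQ.
Qed.

Lemma step_add P s d o1 o2 u v s' : onth P (pc s) = Some (IAdd d o1 o2) ->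
  eval s o1 = Some u -> eval s o2 = Some v -> store s d (u + v)%R = Some s' ->
  step P s = Some (goto (pc s).+1 s').
Proof. by rewrite /step /assign => -> -> -> ->. Qed.

Lemma step_sub P s d o1 o2 u v s' : onth P (pc s) = Some (ISub d o1 o2) ->
  eval s o1 = Some u -> eval s o2 = Some v -> store s d (u - v)%R = Some s' ->
  step P s = Some (goto (pc s).+1 s').
Proof. by rewrite /step /assign => -> -> -> ->. Qed.

Lemma step_jump P s o1 o2 l u v : onth P (pc s) = Some (IJumpLe o1 o2 l) ->
  eval s o1 = Some u -> eval s o2 = Some v ->
  step P s = Some (goto (if (u <= v)%R then l else (pc s).+1) s).
Proof. by rewrite /step => -> -> ->. Qed.

(** [Aux] is the current position. Instructions 0 to 2 advance it and halt past the end, 3 tests the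
    sign, 4 copies the left neighbour and 6 negates. The comparison of [0] with [0] is an
    unconditional jump. *)
Definition fill_program : program :=
  [:: IAdd ToAux Aux (Const 1);
      IJumpLe Aux Len 3;
      IHalt;
      IJumpLe (Cell (Indexed 0)) (Const 0) 6;
      IAdd (ToCell (Indexed 0)) (Cell (Indexed (-1)%R)) (Const 0);
      IJumpLe (Const 0) (Const 0) 0;
      ISub (ToCell (Indexed 0)) (Const 0) (Cell (Indexed 0));
      IJumpLe (Const 0) (Const 0) 0].

(** Interface between the machine and the combinatorics: the local rule linking input and output
    that makes the left-to-right pass correct. The conjunct [0 < j] ensures that a copied neighbour
    exists. *)
Definition filled (g r : seq int) : Prop :=
  forall j, j < size g ->
    if (nth 0 g j <= 0)%R then nth 0%R r j = (- nth 0 g j)%R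
    else 0 < j /\ nth 0%R r j = nth 0%R r j.-1.

(** * Correctness, time and space of the one-pass program *)

Section FillProgram.

Variables g r : seq int.
Hypothesis size_r : size r = size g.
Hypothesis g_gt0 : 0 < size g.
Hypothesis g_le : all (fun z : int => `|z|%N <= size g) g.
Hypothesis r_le : all (fun z : int => `|z|%N <= size g) r.
Hypothesis g_filled : filled g r.

(** Loop invariant: the array once the first [i] cells are final. *)
Let mix i := take i r ++ drop i g.

Lemma size_mix i : i <= size g -> size (mix i) = size g.
Proof. by move=> Hi; rewrite size_cat size_takel ?size_r // size_drop subnKC. Qed.

Lemma nth_mix i k : i <= size g ->
  nth 0%R (mix i) k = if k < i then nth 0%R r k else nth 0%R g k.
Proof.
move=> Hi; rewrite nth_cat size_takel ?size_r //.
by case: ltnP => Hk; [rewrite nth_take | rewrite nth_drop subnKC].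
Qed.

Lemma set_nth_mix i : i < size g ->
  set_nth 0%R (mix i) i (nth 0%R r i) = mix i.+1.
Proof.
move=> Hi; apply: (@eq_from_nth _ 0%R) => [|k _].
  by rewrite size_set_nth !size_mix ?(ltnW Hi) //; apply/maxn_idPr.
rewrite nth_set_nth /= !nth_mix ?(ltnW Hi) // ltnS.
by case: ltngtP => [||->].
Qed.

(** The index overshoots to [n + 1] before the exit test; since [n >= 1], this is at most [2 * n],
    whence the constant 2. *)
Lemma fits_mix l i j : j <= size g -> i <= (size g).+1 ->
  fits 2 (size g) (Config l (Posz i) (mix j)).
Proof.
move=> Hj Hi; split=> /=; first by lia.
rewrite all_cat; apply/andP; split; apply/allP=> z Hz.
  by move/allP: r_le; apply; apply: mem_take Hz.
by move/allP: g_le; apply; apply: mem_drop Hz.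
Qed.

Lemma read_mix i k l a : i <= size g -> k < size g ->
  read_cell (Config l a (mix i)) (Posz k.+1) = Some (nth 0%R (mix i) k).
Proof. by move=> Hi Hk; rewrite /= onthE (nth_map 0%R) // size_mix. Qed.

(** Both branches take five steps: increment, exit test, sign test, write, jump back. After the
    increment, [i.+1] is the one-based address of the zero-based cell [i]. *)
Lemma fill_program_iteration i : i < size g ->
  execution fill_program (fits 2 (size g)) 5
    (Config 0 (Posz i) (mix i)) (Config 0 (Posz i.+1) (mix i.+1)).
Proof.
move=> Hi; have Hi' := ltnW Hi.
have addi1 : (Posz i + 1)%R = Posz i.+1 by lia.
have resolvei l a : resolve (Config l (Posz i.+1) a) (Indexed 0) = Posz i.+1.
  by rewrite /resolve GRing.addr0.
have fitsi l : fits 2 (size g) (Config l (Posz i.+1) (mix i)).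
  by apply: fits_mix; lia.
have fitsS l : fits 2 (size g) (Config l (Posz i.+1) (mix i.+1)).
  by apply: fits_mix; lia.
have readi l : eval (Config l (Posz i.+1) (mix i)) (Cell (Indexed 0))
    = Some (nth 0%R g i).
  by rewrite /eval resolvei read_mix // nth_mix // ltnn.
have storei l : store (Config l (Posz i.+1) (mix i)) (ToCell (Indexed 0))
    (nth 0%R r i) = Some (Config l (Posz i.+1) (mix i.+1)).
  by rewrite /store resolvei /= size_mix // Hi set_nth_mix.
apply: (@ExecutionCons _ _ _ _ (Config 1 (Posz i.+1) (mix i))).
- by apply: fits_mix; lia.
- by rewrite /step /= /assign /= addi1.
apply: (@ExecutionCons _ _ _ _ (Config 3 (Posz i.+1) (mix i))) => //.
  by rewrite /step /= size_mix // lez_nat Hi.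
have := g_filled Hi; case: ifP => [gi_le0 rE|gi_gt0 [i_gt0 rE]].
- apply: (@ExecutionCons _ _ _ _ (Config 6 (Posz i.+1) (mix i))) => //.
    by rewrite (@step_jump fill_program (Config 3 _ _) _ _ _ _ _ erefl (readi _) erefl) gi_le0.
  apply: (@ExecutionCons _ _ _ _ (Config 7 (Posz i.+1) (mix i.+1))) => //.
    rewrite (@step_sub fill_program (Config 6 _ _) _ _ _ _ _
      (Config 6 (Posz i.+1) (mix i.+1)) erefl erefl (readi _)) //.
    by rewrite GRing.sub0r -rE storei.
  apply: (@ExecutionCons _ _ _ _ (Config 0 (Posz i.+1) (mix i.+1))) => //.
  exact: ExecutionNil.
- apply: (@ExecutionCons _ _ _ _ (Config 4 (Posz i.+1) (mix i))) => //.
    by rewrite (@step_jump fill_program (Config 3 _ _) _ _ _ _ _ erefl (readi _) erefl) gi_gt0.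
  apply: (@ExecutionCons _ _ _ _ (Config 5 (Posz i.+1) (mix i.+1))) => //.
    (* The left neighbour already holds its final value, which equals [r] at [i] by [rE]; [0 < i]
       makes its address valid. *)
    have readp : eval (Config 4 (Posz i.+1) (mix i)) (Cell (Indexed (-1)%R))
        = Some (nth 0%R r i).
      rewrite /eval /resolve [aux _]/=.
      have -> : (Posz i.+1 + -1)%R = Posz i.-1.+1 by lia.
      rewrite read_mix ?nth_mix ?ltn_predL ?i_gt0 -?rE //; lia.
    rewrite (@step_add fill_program (Config 4 _ _) _ _ _ _ _
      (Config 4 (Posz i.+1) (mix i.+1)) erefl readp erefl) //.
    by rewrite GRing.addr0 storei.
  apply: (@ExecutionCons _ _ _ _ (Config 0 (Posz i.+1) (mix i.+1))) => //.
  exact: ExecutionNil.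
Qed.

Lemma fill_program_loop i : i <= size g ->
  execution fill_program (fits 2 (size g)) (i * 5)
    (Config 0 0%R g) (Config 0 (Posz i) (mix i)).
Proof.
elim: i => [_|i IH Hi].
  have mix0 : mix 0 = g by rewrite /mix take0 drop0.
  by rewrite -[X in Config _ _ X]mix0; apply/ExecutionNil/fits_mix.
rewrite mulSnr; apply: execution_trans (IH (ltnW Hi)) _.
exact: fill_program_iteration.
Qed.

Lemma fill_program_computes : computes_in_place fill_program (7 * size g) 2 g r.
Proof.
set n := size g; set s := Config 2 (Posz n.+1) (mix n).
have mixn : mix n = r by rewrite /mix /n drop_size cats0 -size_r take_size.
(* The two extra steps are the last increment and the exit test that leads to [IHalt];
   [5 * n + 2 <= 7 * n] because [n >= 1]. *)
have : execution fill_program (fits 2 n) (n * 5 + 2) (Config 0 0%R g) s.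
  apply: execution_trans (fill_program_loop (leqnn n)) _.
  apply: (@ExecutionCons _ _ _ _ (Config 1 (Posz n.+1) (mix n))).
  - exact: fits_mix.
  - have addn1 : (Posz n + 1)%R = Posz n.+1 by lia.
    by rewrite /step /= /assign /= addn1.
  apply: (@ExecutionCons _ _ _ _ s); first exact: fits_mix.
    by rewrite /step /= size_mix // lez_nat ltnn.
  by apply: ExecutionNil; apply: fits_mix.
case/execution_iter=> Hrun Hfits; exists (n * 5 + 2), s; split=> //.
by move: g_gt0; rewrite -/n; lia.
Qed.

End FillProgram.

(** * Classes as intervals of values, and the sorted arrangement *)

Lemma sorted_enum_ord n (B : {pred 'I_n}) : sorted (relpre val ltn) (enum B).
Proof.
rewrite /enum_mem; apply: sorted_filter => [x y z|]; first exact: ltn_trans.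
by rewrite -enumT -sorted_map val_enum_ord iota_ltn_sorted.
Qed.

Lemma nth_a_seq n (A : {set 'I_n}) (i : 'I_#|A|) :
  nth 0 (a_seq A) i = (enum_val i).+1.
Proof.
rewrite (nth_map (enum_val i)) -?cardE ?ltn_ord //.
by rewrite -(enum_val_nth (enum_val i)).
Qed.

Section Arrangement.

Variables (n : nat) (f : 'I_n -> 'I_n) (pi : {perm 'I_n}) (A : {set 'I_n}).
Hypothesis f_idem : idempotent_fun f.
Hypothesis pi_idem : idempotent_perm pi A.
Hypothesis pi_f : corresponds pi A f.

Lemma size_c_seq : size (c_seq pi A) = #|A|.
Proof. by rewrite size_map cardE. Qed.

Lemma c_at_lt i j : i < j <= #|A| -> c_at pi A i < c_at pi A j.
Proof.
case/andP=> ij; rewrite leq_eqVlt => /orP[/eqP jA|jA].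
  (* At index [#|A|] the default [n.+1] plays the part of the closing bound and exceeds every listed
     value. *)
  rewrite {2}/c_at nth_default ?size_c_seq ?jA // ltnS /c_at.
  have: nth n.+1 (c_seq pi A) i \in c_seq pi A.
    by apply: mem_nth; rewrite size_c_seq -jA.
  by case/mapP=> a _ ->.
case/and3P: pi_idem => _ _ sorted_c.
by apply: (sorted_ltn_nth ltn_trans) => //; rewrite inE size_c_seq //; lia.
Qed.

Lemma c_at_le_index i j : i < #|A| -> c_at pi A i < c_at pi A j.+1 -> i <= j.
Proof.
move=> Hi; apply: contraTT; rewrite -!ltnNge ltnS => ji.
move: ji; rewrite leq_eqVlt => /orP[/eqP -> //|ji].
by apply/ltnW/c_at_lt; rewrite ji ltnW.
Qed.

(** By idempotence [f x] is a fixed point for [x = pi^-1 y], so [x] lies in its class;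
    correspondence turns this into bounds on [pi x = y]. *)
Lemma fixed_class (y : 'I_n) : exists i : 'I_#|A|,
  c_at pi A i <= y.+1 < c_at pi A i.+1 /\ f (pi^-1%g y) = enum_val i.
Proof.
case: pi_f => AE classE; set x := pi^-1%g y.
have fxA : f x \in A by rewrite AE inE; apply/eqP/f_idem.
exists (enum_rank_in fxA (f x)); rewrite enum_rankK_in //; split=> //.
have := classE (enum_rank_in fxA (f x)); move/setP/(_ x).
by rewrite !inE enum_rankK_in // eqxx permKV.
Qed.

Lemma class_value (y : 'I_n) (i : 'I_#|A|) :
  c_at pi A i <= y.+1 < c_at pi A i.+1 -> f (pi^-1%g y) = enum_val i.
Proof.
case: pi_f => _ classE yi; have /setP/(_ (pi^-1%g y)) := classE i.
by rewrite !inE permKV yi => /esym/eqP.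
Qed.

(** The intervals follow one another in the order of their indices, and the fixed points increase
    with the index. *)
Lemma fixed_value_mono (y z : 'I_n) : y <= z -> f (pi^-1%g y) <= f (pi^-1%g z).
Proof.
move=> yz; have [i [/andP[iy _] ->]] := fixed_class y.
have [j [/andP[_ zj] ->]] := fixed_class z.
have ij : i <= j by apply: c_at_le_index; rewrite ?ltn_ord //; lia.
suff: nth 0 (a_seq A) i <= nth 0 (a_seq A) j by rewrite !nth_a_seq.
apply: (sorted_leq_nth leq_trans leqnn); rewrite ?inE ?size_map -?cardE //.
by rewrite sorted_map; apply: sub_sorted (sorted_enum_ord A) => a b; apply: ltnW.
Qed.

(** The right-hand side is nondecreasing and, [pi^-1] being a bijection, rearranges the values of
    [f]; a sorted rearrangement is unique. *)
Lemma linear_arrangementE : linear_arrangement f =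
  [seq Posz (f (pi^-1%g y)).+1 | y <- enum 'I_n].
Proof.
rewrite [RHS](map_comp Posz (fun y => (f (pi^-1%g y)).+1)); congr map.
apply: (sorted_eq leq_trans anti_leq).
- exact: sort_sorted leq_total _.
- apply: homo_sorted (sorted_enum_ord _) => y z yz.
  by rewrite ltnS fixed_value_mono // ltnW.
- rewrite perm_sort (map_comp (fun x => (f x).+1) pi^-1%g); apply: perm_map.
  apply: uniq_perm; rewrite ?(map_inj_uniq perm_inj) ?enum_uniq // => x.
  by rewrite mem_enum -[x](permK pi) map_f ?mem_enum.
Qed.

Lemma size_linear_arrangement : size (linear_arrangement f) = n.
Proof. by rewrite linear_arrangementE size_map size_enum_ord. Qed.

Lemma nth_linear_arrangement (y : 'I_n) :
  nth 0%R (linear_arrangement f) y = Posz (f (pi^-1%g y)).+1.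
Proof.
by rewrite linear_arrangementE (nth_map y) ?size_enum_ord // nth_ord_enum.
Qed.

Lemma linear_arrangement_le :
  all (fun z : int => `|z|%N <= n) (linear_arrangement f).
Proof. by rewrite linear_arrangementE all_map; apply/allP=> y _ /=. Qed.

(** * The entries of [gamma] obey the local rule *)

Lemma size_gamma : size (gamma pi A) = n.
Proof. by rewrite size_map size_iota. Qed.

Lemma nth_gamma_in j : j < n -> j.+1 \in c_seq pi A ->
  exists i : 'I_#|A|, c_at pi A i = j.+1 /\
    nth 0%R (gamma pi A) j = (- Posz (enum_val i).+1)%R.
Proof.
move=> jn jc; have iA : index j.+1 (c_seq pi A) < #|A|.
  by rewrite -size_c_seq index_mem.
exists (Ordinal iA); split; first by rewrite /c_at nth_index.
by rewrite (nth_map 0) ?size_iota // nth_iota // add1n jc -nth_a_seq.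
Qed.

Lemma nth_gamma_notin j : j < n -> j.+1 \notin c_seq pi A ->
  nth 0%R (gamma pi A) j = Posz j.+1.
Proof.
by move=> jn /negPf jc; rewrite (nth_map 0) ?size_iota // nth_iota // add1n jc.
Qed.

Lemma gamma_le : all (fun z : int => `|z|%N <= n) (gamma pi A).
Proof.
apply/(all_nthP 0%R) => j; rewrite size_gamma => jn.
have [jc|jc] := boolP (j.+1 \in c_seq pi A).
  by have [i [_ ->]] := nth_gamma_in jn jc; have := ltn_ord (enum_val i); lia.
by rewrite nth_gamma_notin.
Qed.

Lemma card_degree_gt0 : 0 < #|A|.
Proof. by case/and3P: pi_idem; rewrite -card_gt0. Qed.

(** A position [c_i] starts the interval with value [a_i]. Any other position is strictly inside an
    interval, so its left neighbour shares its value. *)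
Lemma gamma_filled : filled (gamma pi A) (linear_arrangement f).
Proof.
move=> j; rewrite size_gamma => jn.
have nthj : nth 0%R (linear_arrangement f) j = _ :=
  nth_linear_arrangement (Ordinal jn).
have [jc|jc] := boolP (j.+1 \in c_seq pi A).
  have [i [ci ->]] := nth_gamma_in jn jc.
  rewrite (_ : (- _ <= 0)%R = true); last by lia.
  rewrite GRing.opprK nthj (@class_value _ i) //.
  by rewrite /= ci leqnn -ci c_at_lt // ltnSn ltn_ord.
rewrite nth_gamma_notin // (_ : (_ <= 0)%R = false); last by lia.
have [i [/andP[cij jci] fE]] := fixed_class (Ordinal jn).
have cij' : c_at pi A i < j.+1.
  rewrite ltn_neqAle cij andbT; apply: contraNneq jc => <-.
  by rewrite mem_nth ?size_c_seq.
(* The normalisation [c_1 = 1] puts the first position among the [c_i]. *)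
have j_gt0 : 0 < j.
  case: (posnP j) jc => // -> /negP[]; case/and3P: pi_idem => _ /eqP <- _.
  by rewrite mem_nth ?size_c_seq ?card_degree_gt0.
have pn : j.-1 < n by lia.
split=> //; rewrite nthj (nth_linear_arrangement (Ordinal pn)) fE.
by rewrite (@class_value _ i) // [val _]/= prednK // -ltnS cij' ltnW.
Qed.

Lemma ground_set_gt0 : 0 < n.
Proof.
by have := card_degree_gt0; rewrite card_gt0 => /set0Pn[a _]; case: n a => [[]|].
Qed.

End Arrangement.

Theorem theorem3p23 :
  exists (P : program) (ct cs : nat),
    forall (n : nat) (f : 'I_n -> 'I_n) (pi : {perm 'I_n}) (A : {set 'I_n}),
      idempotent_fun f ->
      idempotent_perm pi A ->
      corresponds pi A f ->
      computes_in_place P (ct * n) cs (gamma pi A) (linear_arrangement f).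
Proof.
exists fill_program, 7, 2 => n f pi A f_idem pi_idem pi_f.
rewrite -[in 7 * n](size_gamma pi A).
apply: fill_program_computes; rewrite ?size_gamma.
- exact: (size_linear_arrangement f_idem pi_idem pi_f).
- exact: ground_set_gt0 pi_idem.
- exact: gamma_le.
- exact: (linear_arrangement_le f_idem pi_idem pi_f).
- exact: gamma_filled f_idem pi_idem pi_f.
Qed.
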